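(* Let $G$ and $M$ be finite groups with $|M|=|G|$. If there is at least one positive integer $m$ dividing $|G|$ such that $$|\mathrm{CharSub}_m(M)|>|\mathrm{Sub}_m(G)|,$$ then $R(G,[M])=\varnothing$.
   Context: For a finite group $G$, let $B=\mathrm{Perm}(G)$ be the group of all permutations of the underlying set of $G$, and let $\lambda:G\hookrightarrow B$ be the left regular representation, $\lambda(g)(h)=gh$. A subgroup $N\leq B$ is regular if it acts transitively and fixed point freely on $G$ (so $|N|=|G|$). For a group $M$ with $|M|=|G|$, $[M]$ denotes its isomorphism class and $$R(G,[M])=\{N\leq B \mid N \text{ is regular},\ \lambda(G)\leq \mathrm{Norm}_B(N),\ N\cong M\},$$ where $\mathrm{Norm}_B(N)$ is the normalizer of $N$ in $B$. For a positive integer $m$ dividing $|G|$, $\mathrm{Sub}_m(G)$ is the set of subgroups of $G$ of order $m$, and $\mathrm{CharSub}_m(M)$ is the set of characteristic subgroups of $M$ of order $m$ (a subgroup is characteristic if it is mapped to itself by every automorphism of $M$). *)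

(* Defs.v *)
From mathcomp Require Import all_boot all_fingroup.

Set Implicit Arguments.
Unset Strict Implicit.
Unset Printing Implicit Defensive.

Local Open Scope group_scope.

(* Finite groups are represented by finGroupTypes, so that Perm(G) is         *)
(* {perm G}.  The product of {perm G} is composition from left to right:      *)
(* (s * t) x = t (s x) (permM).  With composition from right to left one gets *)
(* the opposite group, which has the same subgroups, with the same            *)
(* normalizers and, up to isomorphism, the same group structure.              *)

(* h |-> g * h; a permutation because mulgI g : injective (mulg g).           *)
Definition lambda (G : finGroupType) (g : G) : {perm G} := perm (@mulgI G g).

Definition lambdaG (G : finGroupType) : {set {perm G}} :=
  [set lambda g | g : G].

(* 'P is the natural action of {perm T} on T, and 'C_N[x | 'P] the stabiliser *)
(* of x in N.                                                                 *)
Definition is_regular (T : finType) (N : {group {perm T}}) : bool :=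
  [transitive N, on [set: T] | 'P] && [forall x : T, 'C_N[x | 'P] == 1].

(* R(G, [M]); belonging to the isomorphism class [M] is expressed by \isog.   *)
Definition Rset (G M : finGroupType) : {set {group {perm G}}} :=
  [set N : {group {perm G}} |
    [&& is_regular N, lambdaG G \subset 'N(N) & N \isog [set: M]]].

Definition SubOrd (m : nat) (G : finGroupType) : {set {group G}} :=
  [set H : {group G} | #|H| == m].

Definition CharSubOrd (m : nat) (M : finGroupType) : {set {group M}} :=
  [set H : {group M} | (H \char [set: M]) && (#|H| == m)].

(* Main.v *)
Require Import Defs.
From mathcomp Require Import all_boot all_fingroup.

(** Let [N] be a regular subgroup of [Perm(G)] normalized by [lambda(G)].
    Evaluation at the identity, [n |-> n 1], is a bijection from [N] to [G].
    It is not a homomorphism in general, but it maps every subgroup [H] of [N]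
    that [lambda(G)] normalizes onto a subgroup of [G]
    ([group_set_orbit1]), namely the [H]-orbit of [1].  The characteristic
    subgroups of [N] are normalized by [lambda(G)] because [N] is; distinct
    subgroups of [N] have distinct orbits, of the same orders as the subgroups
    themselves.  Hence [N] has at most as many characteristic subgroups of
    order [m] as [G] has subgroups of order [m], and an isomorphism of [N]
    with [M] carries this bound over to [M] ([card_CharSubOrd_leq]). *)

Local Open Scope group_scope.

(** For [h, k] in [H] and [g := h 1], the product of [g] and [k 1] is
    [lambda g] applied to [k 1], which is also the conjugate of [k] by
    [lambda g] applied to [g = h 1]; the conjugate stays in [H], so the product
    lies in the [H]-orbit of [1].  Closure under inverses is automatic in a
    finite group. *)
Lemma group_set_orbit1 (G : finGroupType) (H : {group {perm G}}) :
  lambdaG G \subset 'N(H) -> group_set (orbit 'P H 1).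
Proof.
move=> /subsetP nHG; apply/group_setP; split; first exact: orbit_refl.
move=> _ _ /orbitP[h Hh <-] /orbitP[k Hk <-]; rewrite /= !apermE.
have nHh: lambda (h 1) \in 'N(H) by rewrite nHG ?imset_f.
apply/orbitP; exists (h * k ^ lambda (h 1)); first by rewrite groupM ?memJ_norm.
rewrite /= apermE permM.
have {2}->: h 1 = lambda (h 1) 1 by rewrite permE mulg1.
by rewrite permJ permE.
Qed.

Lemma regular_inj (T : finType) (N : {group {perm T}}) (x : T) :
  is_regular N -> {in N &, injective (aperm x)}.
Proof.
case/andP=> _ /forallP/(_ x)/eqP fixN1 s t Ns Nt eq_st.
apply/eqP; rewrite eq_mulgV1; apply/eqP/set1P.
rewrite -[[set _]]fixN1 inE groupM ?groupV //=.
by apply/astab1P; rewrite /= !apermE permM -!apermE eq_st actK.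
Qed.

Lemma regular_orbit_sub (T : finType) (N H K : {group {perm T}}) (x : T) :
    is_regular N -> H \subset N -> K \subset N ->
  orbit 'P H x \subset orbit 'P K x -> H \subset K.
Proof.
move=> regN /subsetP sHN /subsetP sKN /subsetP sOHK.
apply/subsetP=> h Hh; have /sOHK/orbitP[k Kk] := mem_orbit 'P x Hh.
by move/(regular_inj _ _ x regN) => <- //; [apply: sKN | apply: sHN].
Qed.

Lemma card_CharSubOrd_leq (G M : finGroupType) (N : {group {perm G}}) (m : nat) :
  N \in Rset G M -> #|CharSubOrd m M| <= #|SubOrd m G|.
Proof.
rewrite inE isog_sym => /and3P[regN nNG /isogP[f injf fM]].
have sfN (K : {group M}) : f @* K \subset N by rewrite -fM morphimS ?subsetT.
have gen_orbit (K : {group M}) : K \char [set: M] ->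
  <<orbit 'P (f @* K) 1>> = orbit 'P (f @* K) 1.
  move=> chK; apply: (@gen_set_id _ (orbit 'P (f @* K) 1)).
  apply: group_set_orbit1; apply: subset_trans nNG _; apply: char_norms.
  by rewrite -fM injm_char.
(* Orbits are turned into elements of the type of groups by taking generated
   subgroups, which on the relevant orbits changes nothing. *)
pose Phi (K : {group M}) := <<orbit 'P (f @* K) 1>>%G.
rewrite -(@card_in_imset _ _ Phi) => [|K L].
  apply/subset_leq_card/subsetP=> _ /imsetP[K + ->].
  rewrite !inE => /andP[chK /eqP <-]; rewrite /= gen_orbit //.
  have injO : {in f @* K &, injective (aperm (1 : G))}.
    by apply: sub_in2 (regular_inj _ _ 1 regN); apply/subsetP/sfN.
  by rewrite (card_in_imset injO) card_injm ?subsetT.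
rewrite !inE => /andP[chK _] /andP[chL _] /(congr1 val) /=.
rewrite !gen_orbit // => eqO; apply/val_inj/(injm_morphim_inj injf);
  rewrite ?subsetT //.
apply/eqP; rewrite eqEsubset; apply/andP; split;
  by apply: (regular_orbit_sub _ N _ _ 1); rewrite ?sfN ?eqO.
Qed.

Local Close Scope group_scope.

Theorem mainTheorem1 (G M : finGroupType) (cardMG : #|M| = #|G|)
    (Hm : exists m : nat,
        [/\ 0 < m, m %| #|G| & #|CharSubOrd m M| > #|SubOrd m G|]) :
  Rset G M = set0.
Proof.
case: Hm => m [_ _ ltGM]; apply/setP=> N; rewrite in_set0.
by apply/negP=> /(card_CharSubOrd_leq _ _ _ m); rewrite leqNgt ltGM.
Qed.
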